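(* Let $d>1$ be a square-free integer with $d\equiv 2$ or $3\pmod 4$ such that $K=\mathbb{Q}(\sqrt d)$ has class number $1$. Let $\alpha\in\mathcal{O}_K$ be such that $u=\alpha-1$ is a unit of $\mathcal{O}_K$ with $N(\alpha-1)=N(u)=-1$. Then $\alpha$ is irreducible in $\mathcal{O}_K$ if and only if $d=2$ and $u\in\{1+\sqrt2,\;1-\sqrt2,\;-1+\sqrt2,\;-1-\sqrt2\}$.
   Context: $\mathcal{O}_K$ is the ring of integers of $K=\mathbb{Q}(\sqrt d)$; for $d\equiv 2,3\pmod 4$ it equals $\mathbb{Z}[\sqrt d]$. $N$ denotes the field norm from $K$ to $\mathbb{Q}$, so $N(a+b\sqrt d)=a^2-db^2$. *)

(* Defs.v *)
From HB Require Import structures.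
From mathcomp Require Import all_boot all_order all_algebra all_fingroup
  all_solvable all_field.

Set Implicit Arguments.
Unset Strict Implicit.
Unset Printing Implicit Defensive.

Import Order.TTheory GRing.Theory Num.Theory.
Local Open Scope ring_scope.

Definition squarefreez (d : int) : Prop :=
  forall m : int, (m ^+ 2 %| d)%Z -> m = 1 \/ m = -1.

(* K is generated over the rationals by s, a chosen square root of d. *)
Definition is_quadratic_field (d : int) (K : splittingFieldType rat) (s : K) :=
  s ^+ 2 = d%:~R /\ <<1; s>>%VS = {:K}%VS.

Definition ring_of_integers (K : splittingFieldType rat) : K -> Prop :=
  integralOver (intr : int -> K).

(* The norm from K to the rationals when K is Galois over the rationals;
   its values lie in the copy of the rationals inside K. *)
Definition field_norm (K : splittingFieldType rat) (x : K) : K :=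
  galNorm 1%VS {:K}%VS x.

(* A subring of a field is given by its membership predicate O; units,
   irreducibles and ideal classes below are those of the ring O. *)
Section Subring.

Variables (K : fieldType) (O : K -> Prop).

Definition unit_of (x : K) : Prop := O x /\ exists2 y, O y & x * y = 1.

Definition irreducible_of (x : K) : Prop :=
  [/\ O x, x <> 0, ~ unit_of x
    & forall y z, O y -> O z -> x = y * z -> unit_of y \/ unit_of z].

Record fractional_ideal (I : K -> Prop) : Prop := FractionalIdeal {
  frac_ideal0 : I 0;
  frac_idealD : forall x y, I x -> I y -> I (x + y);
  frac_idealM : forall a x, O a -> I x -> I (a * x);
  frac_ideal_neq0 : exists2 x, I x & x <> 0;
  frac_ideal_denom : exists c, [/\ O c, c <> 0 & forall x, I x -> O (c * x)]
}.

(* J = k I for some nonzero k, i.e. I and J differ by a principal fractional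
   ideal. *)
Definition same_ideal_class (I J : K -> Prop) : Prop :=
  exists2 k : K, k <> 0 & forall y, J y <-> exists2 x, I x & y = k * x.

(* There are exactly h classes of nonzero fractional ideals: c lists one
   representative of each class. *)
Definition has_class_number (h : nat) : Prop :=
  exists c : 'I_h -> K -> Prop,
    [/\ forall i, fractional_ideal (c i),
        forall i j, same_ideal_class (c i) (c j) -> i = j
      & forall I, fractional_ideal I -> exists i, same_ideal_class (c i) I].

End Subring.

(* Main.v *)
Require Import Defs.
From HB Require Import structures.
From mathcomp Require Import all_boot all_order all_algebra all_fingroup
  all_solvable all_field.
From mathcomp Require Import zify ring.
Import Order.TTheory GRing.Theory Num.Theory.
Local Open Scope ring_scope.

(** Write [u = a + b s] with [s] the square root of [d] and [a], [b] integers,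
    so that [a^2 - d b^2 = -1] and [N(alpha) = (a + 1)^2 - d b^2 = 2 a].  The
    point is that the prime 2 ramifies and that [alpha] always lies in the
    prime ideal above it.

    Reading [a^2 - d b^2 = -1] modulo 4 shows that [d] is even and [a] is odd
    ([even_odd_of_norm_minus_one]).  As [d] is even, the elements
    [2 x + y s] form an ideal [I] that contains 2 and not 1
    ([ideal_above_two]), and [a] odd puts [alpha = (a + 1) + b s] in [I].
    Class number 1 makes [I] principal, [I = (g)]
    ([principal_of_class_number_one]), and [g] is not a unit.  If [alpha] is
    irreducible, then [alpha] is [g] times a unit, hence [alpha] divides 2.
    Taking norms, [2 a] divides 4, so the odd integer [a] is 1 or -1, then
    [d b^2 = a^2 + 1 = 2], which leaves [d = 2] and [b = 1] or [b = -1].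

    Conversely, if [d = 2] and [u] is one of the four given units, then
    [N(alpha) = 2 a] is 2 or -2, and an integer whose norm is prime is
    irreducible ([irreducible_of_prime_norm]).

    This arithmetic takes place in coordinates, which rest on two facts about
    the quadratic field.  The Galois group has exactly one nontrivial element
    and it sends [s] to [- s] ([conjugation]), which gives the norm the form
    [a^2 - d b^2].  Every algebraic integer has integral coordinates
    ([ring_of_integersP]): its trace and norm are rational and integral over
    the integers, hence integers, and the hypotheses on [d] remove the
    denominators. *)

Set Implicit Arguments.
Unset Strict Implicit.
Unset Printing Implicit Defensive.

(** * Integers, rationals and algebraic integers *)

Lemma int_inj_ext (K : fieldExtType rat) : injective (intr : int -> K).
Proof.
move=> m n; rewrite -!(rmorph_int (in_alg K)) => /(fmorph_inj (in_alg K)).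
exact: intr_inj.
Qed.

Lemma integral_int (R : comNzRingType) (n : int) :
  integralOver (intr : int -> R) n%:~R.
Proof. exact: (integral_id (intr : {rmorphism int -> R})). Qed.

(** The integers are integrally closed in the rationals; the proof moves the
    equation of [q] to the algebraic numbers, where the result is known. *)
Lemma rat_int_of_integral (K : fieldExtType rat) (q : rat) :
  integralOver (intr : int -> K) q%:A -> exists n : int, q = n%:~R.
Proof.
case=> p p_monic p_root.
have {}p_root : root (map_poly (intr : int -> rat) p) q.
  move: p_root; rewrite -(fmorph_root (in_alg K)) -map_poly_comp /=.
  by rewrite (eq_map_poly (fun n => rmorph_int (in_alg K) n)).
have q_Aint : (ratr q : algC) \in Aint.
  apply: (@root_monic_Aint (map_poly intr p)).
  - rewrite -(eq_map_poly (fun n => ratr_int algC n)).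
    by rewrite (map_poly_comp (ratr : rat -> algC) intr) fmorph_root.
  - exact: monic_map.
  - by apply/polyOverP=> i; rewrite coef_map /= intr_int.
have /intrP[n qn] := Cint_rat_Aint (Crat_rat q) q_Aint.
exists n; apply: (fmorph_inj (ratr : {rmorphism rat -> algC})).
by rewrite /= ratr_int.
Qed.

(** The square of the denominator of [b] has to divide [d], so this
    denominator is 1. *)
Lemma rat_int_of_squarefree (d : int) (b : rat) :
  squarefreez d -> (exists n : int, d%:~R * b ^+ 2 = n%:~R) ->
  exists m : int, b = m%:~R.
Proof.
move=> d_sqfree [n db2n].
have eq_int : d * numq b ^+ 2 = n * denq b ^+ 2.
  apply: (@intr_inj rat); rewrite !expr2 !intrM -db2n expr2.
  by rewrite numqE; ring.
have /d_sqfree den1 : (denq b ^+ 2 %| d)%Z.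
  have coprime_sqr : coprimez (denq b ^+ 2) (numq b ^+ 2).
    rewrite /coprimez gcdzC -/(coprimez _ _) coprimezXl // coprimezXr //.
    by rewrite coprimezE coprime_num_den.
  by rewrite -(Gauss_dvdzl d coprime_sqr) eq_int dvdz_mull.
exists (numq b).
have {}den1 : denq b = 1 by case: den1 (denq_gt0 b) => ->.
by rewrite -{1}(divq_num_den b) den1 divr1.
Qed.

(** * Norm equations modulo 4 *)

(** This is where the residue of [d] modulo 4 enters: it excludes integers
    such as [(1 + s) / 2], which exist when [d] is 1 modulo 4. *)
Lemma even_of_norm_mod4 (d a b n : int) :
  (d = 2 %[mod 4])%Z \/ (d = 3 %[mod 4])%Z ->
  a ^+ 2 - d * b ^+ 2 = 4 * n ->
  (exists a', a = 2 * a') /\ (exists b', b = 2 * b').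
Proof.
move=> d_mod4 eq4.
have [k [d_eq|d_eq]] : exists k : int, d = 4 * k + 2 \/ d = 4 * k + 3.
  by exists (d %/ 4)%Z; case: d_mod4 => h; [left|right]; lia.
all: move: eq4; rewrite {d_mod4} d_eq {d d_eq} => eq4.
all: have [x [a_eq|a_eq]] : exists x : int, a = 2 * x \/ a = 2 * x + 1
  by exists (a %/ 2)%Z; lia.
all: have [y [b_eq|b_eq]] : exists y : int, b = 2 * y \/ b = 2 * y + 1
  by exists (b %/ 2)%Z; lia.
all: try by split; [exists x | exists y].
all: by move: eq4; rewrite a_eq b_eq !expr2; lia.
Qed.

(** When [d] is 3 modulo 4, the sum of squares [a^2 + b^2] would be 3
    modulo 4. *)
Lemma even_odd_of_norm_minus_one (d a b : int) :
  (d = 2 %[mod 4])%Z \/ (d = 3 %[mod 4])%Z -> a ^+ 2 - d * b ^+ 2 = -1 ->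
  (exists k, d = 2 * k) /\ (exists c, a = 2 * c + 1).
Proof.
move=> d_mod4 norm_eq.
have [k [d_eq|d_eq]] : exists k : int, d = 4 * k + 2 \/ d = 4 * k + 3.
  by exists (d %/ 4)%Z; case: d_mod4 => h; [left|right]; lia.
all: move: norm_eq; rewrite {d_mod4} d_eq {d d_eq} => norm_eq.
all: have [x [a_eq|a_eq]] : exists x : int, a = 2 * x \/ a = 2 * x + 1
  by exists (a %/ 2)%Z; lia.
all: have [y [b_eq|b_eq]] : exists y : int, b = 2 * y \/ b = 2 * y + 1
  by exists (b %/ 2)%Z; lia.
all: try by split; [exists (2 * k + 1); lia | exists x].
all: by move: norm_eq; rewrite a_eq b_eq !expr2; lia.
Qed.

(** * Class number one *)

(** The ring [O] is itself a fractional ideal, so the only ideal class is that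
    of [O]. *)
Lemma principal_of_class_number_one (K : fieldType) (O I : K -> Prop) :
  fractional_ideal O O -> has_class_number O 1 -> fractional_ideal O I ->
  exists2 g, g <> 0 & forall y, I y <-> exists2 x, O x & y = g * x.
Proof.
move=> O_frac [c [_ _ c_all]] I_frac.
have [i [k /eqP k_neq0 Ok]] := c_all _ O_frac.
have [j [l /eqP l_neq0 Il]] := c_all _ I_frac.
rewrite (ord1 i) in Ok; rewrite (ord1 j) in Il.
exists (l / k) => [|y]; first by apply/eqP; rewrite mulf_neq0 ?invr_eq0.
rewrite Il; split=> -[x].
  move=> cx ->; exists (k * x); first by apply/Ok; exists x.
  by rewrite mulrA divfK.
by move=> /Ok[z cz ->] ->; exists z; rewrite // mulrA divfK.
Qed.

Section RingOfIntegers.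

Variable K : splittingFieldType rat.

Lemma ring_of_integers1 : @ring_of_integers K 1.
Proof. exact: (integral1 (intr : {rmorphism int -> K})). Qed.

Lemma ring_of_integers_fractional :
  fractional_ideal (@ring_of_integers K) (@ring_of_integers K).
Proof.
have neq10 : 1 <> 0 :> K by apply/eqP; rewrite oner_eq0.
split; first exact: (integral0 (intr : {rmorphism int -> K})).
- by move=> x y; apply: integral_add.
- by move=> x y; apply: integral_mul.
- by exists 1; first exact: ring_of_integers1.
exists 1; split; [exact: ring_of_integers1 | by [] | by move=> x; rewrite mul1r].
Qed.

Lemma field_normM (x y : K) : field_norm (x * y) = field_norm x * field_norm y.
Proof. exact: galNormM. Qed.

End RingOfIntegers.

Section QuadraticField.

Variables (d : int) (d_gt1 : 1 < d) (d_sqfree : squarefreez d).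
Variables (K : splittingFieldType rat) (s : K).
Hypothesis K_quad : is_quadratic_field d s.

(** * Coordinates and conjugation in a real quadratic field *)

Lemma integral_sqrt : ring_of_integers s.
Proof.
have [s2 _] := K_quad.
exists ('X^2 - d%:P); first exact: monicXnsubC.
by rewrite rmorphB /= map_polyXn map_polyC /= /root !hornerE s2 subrr.
Qed.

(** If [s] is rational then it is an integer, and its square [d] is both
    larger than 1 and squarefree. *)
Lemma sqrt_not_rational : s \notin 1%VS.
Proof.
have [s2 _] := K_quad; apply/negP=> /vlineP[q s_q].
have [n q_n] : exists n : int, q = n%:~R.
  by apply: (@rat_int_of_integral K); rewrite -s_q; exact: integral_sqrt.
have n2 : n ^+ 2 = d.
  apply: (@int_inj_ext K); rewrite -s2 s_q q_n rmorphXn /=.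
  by rewrite -[_%:A]/(in_alg K _) rmorph_int.
have [] : n = 1 \/ n = -1 by apply: d_sqfree; rewrite n2.
all: by move=> n1; move: d_gt1; rewrite -n2 n1.
Qed.

Lemma degree_sqrt : adjoin_degree 1%AS s = 2.
Proof.
have [s2 _] := K_quad.
have deg_neq1 : adjoin_degree 1%AS s != 1.
  by rewrite adjoin_deg_eq1 sqrt_not_rational.
suff : (adjoin_degree 1%AS s <= 2)%N.
  (* The degree is by definition a successor, so it is not 0. *)
  by move: deg_neq1; rewrite /adjoin_degree; case: (_.-1) => [|[|]].
rewrite -ltnS -size_minPoly.
have pO : 'X^2 - (d%:~R)%:P \is a polyOver (1%AS : {subfield K}).
  by rewrite polyOverXnsubC rpred_int.
have /dvdp_leq : minPoly 1%AS s %| 'X^2 - (d%:~R)%:P.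
  by apply: minPoly_dvdp; rewrite // /root !hornerE s2 subrr.
rewrite size_XnsubC // => -> //.
by rewrite -size_poly_gt0 size_XnsubC.
Qed.

Lemma rational_coordinates (x : K) : exists a b : rat, x = a%:A + b%:A * s.
Proof.
have [s2 sK] := K_quad.
have /Fadjoin1_polyP[p ->] : x \in <<1; s>>%VS by rewrite sK memvf.
elim/poly_ind: p => [|p c [a [b IHp]]].
  by exists 0, 0; rewrite rmorph0 horner0 !scale0r mul0r addr0.
exists (b * d%:~R + c), a.
rewrite rmorphD rmorphM /= map_polyX map_polyC !hornerE /= IHp.
by rewrite -[(_ + c)%:A]/(in_alg K _) !rmorphD !rmorphM rmorph_int -s2 /=; ring.
Qed.

Lemma int_coordinates_inj (a b a' b' : int) :
  a%:~R + b%:~R * s = a'%:~R + b'%:~R * s -> a = a' /\ b = b'.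
Proof.
move=> eq_ab; have eq_s : (b - b')%:~R * s = (a' - a)%:~R.
  apply/eqP; rewrite !rmorphB mulrBl subr_eq -(inj_eq (addrI a%:~R)) eq_ab /=.
  by apply/eqP; ring.
have b_eq : b - b' = 0.
  apply/eqP/negPn/negP=> b_neq; case/negP: sqrt_not_rational.
  rewrite -[s](mulKf (x := (b - b')%:~R)) ?eq_s.
    by rewrite rpredM ?rpredV ?rpred_int.
  by rewrite -[0]/(0%:~R) (inj_eq (@int_inj_ext K)).
move/eqP: b_eq eq_s; rewrite subr_eq0 => /eqP ->.
rewrite subrr mul0r -[0]/(0%:~R) => /int_inj_ext /eqP.
by rewrite eq_sym subr_eq0 => /eqP ->.
Qed.

(** The extension is Galois of degree 2, so its group has one nontrivial
    element.  That element moves the generator [s], and it sends [s] to a root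
    of the same equation. *)
Lemma conjugation : exists f : {lrmorphism K -> K},
  f s = - s /\ forall x, field_norm x = x * f x.
Proof.
have [s2 sK] := K_quad.
have galK : galois 1%AS <<1%AS; s>>%AS.
  have -> : <<1%AS; s>>%AS = {:K}%AS by apply/val_inj.
  rewrite /galois sub1v normalFieldf andbT; apply/separableP => y _.
  by apply: pcharf0_separable => p; rewrite (pchar_lalg K) pchar_num.
have card2 : #|'Gal(<<1%AS; s>> / 1%AS)%g| = 2.
  by rewrite -galois_dim // -adjoin_degreeE degree_sqrt.
have one_gal : (1 \in 'Gal(<<1%AS; s>> / 1%AS))%g by apply: group1.
have /eqP/cards1P[g gal1g] : #|('Gal(<<1%AS; s>> / 1%AS) :\ 1)%g| = 1.
  by move: card2; rewrite (cardsD1 1%g) one_gal; case.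
have : g \in ('Gal(<<1%AS; s>> / 1%AS) :\ 1)%g by rewrite gal1g set11.
rewrite !inE => /andP[g_neq1 g_gal].
have gs_neq : g s != s.
  by rewrite -[X in _ != X](gal_id <<1%AS; s>>%AS) -gal_adjoin_eq.
exists g; split.
  have : (g s - s) * (g s + s) = 0.
    by rewrite -subr_sqr -rmorphXn s2 /= (rmorph_int g) subrr.
  by move/eqP; rewrite mulf_eq0 subr_eq0 (negPf gs_neq) addr_eq0 => /eqP.
move=> x; rewrite /field_norm -sK /galNorm (bigD1 1%g) //= gal_id.
congr (_ * _).
transitivity (\prod_(h in [set g]) h x); last by rewrite big_set1.
by apply: eq_bigl => h; rewrite -gal1g !inE andbC.
Qed.

Lemma field_norm_int (a b : int) :
  field_norm (a%:~R + b%:~R * s) = (a ^+ 2 - d * b ^+ 2)%:~R.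
Proof.
have [s2 _] := K_quad; have [f [fs ->]] := conjugation.
by rewrite rmorphD rmorphM !rmorph_int /= fs !expr2 rmorphB !rmorphM /= -s2; ring.
Qed.

(** * The ring of integers and its irreducible elements *)

Hypothesis d_mod4 : (d = 2 %[mod 4])%Z \/ (d = 3 %[mod 4])%Z.

(** If [a + b s] is integral then so are its trace [2 a] and its norm
    [a^2 - d b^2]; these are rational, hence integers.  It follows that
    [d (2 b)^2] is an integer and then, [d] being squarefree, that [2 b] is
    one.  Finally [2 a] and [2 b] are even because 4 divides
    [(2 a)^2 - d (2 b)^2]. *)
Lemma ring_of_integersP (x : K) :
  ring_of_integers x <-> exists a b : int, x = a%:~R + b%:~R * s.
Proof.
split=> [x_int|[a [b ->]]]; last first.
  apply: integral_add; first exact: integral_int.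
  by apply: integral_mul; [exact: integral_int | exact: integral_sqrt].
have [s2 _] := K_quad; have [f [fs _]] := conjugation.
have [a [b x_eq]] := rational_coordinates x.
have fx_int : integralOver (intr : int -> K) (f x).
  have [p p_monic px] := x_int; exists p => //.
  move: px; rewrite -(fmorph_root f) -map_poly_comp /=.
  by rewrite (eq_map_poly (fun n => rmorph_int f n)).
have fx_eq : f x = a%:A - b%:A * s.
  by rewrite x_eq rmorphD rmorphM /= !rmorph_alg fs mulrN.
have [A a_eq] : exists A : int, 2 * a = A%:~R.
  apply: (@rat_int_of_integral K).
  suff -> : (2 * a)%:A = x + f x by apply: integral_add.
  rewrite fx_eq x_eq -[(2 * a)%:A]/(in_alg K _) rmorphM (rmorph_nat _ 2) /=.
  by ring.
have [n n_eq] : exists n : int, a ^+ 2 - d%:~R * b ^+ 2 = n%:~R.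
  apply: (@rat_int_of_integral K).
  suff -> : (a ^+ 2 - d%:~R * b ^+ 2)%:A = x * f x by apply: integral_mul.
  rewrite fx_eq x_eq -[(a ^+ 2 - _)%:A]/(in_alg K _) !expr2 rmorphB !rmorphM.
  by rewrite rmorph_int -s2 /=; ring.
have [B b_eq] : exists B : int, 2 * b = B%:~R.
  apply: (rat_int_of_squarefree d_sqfree); exists (A ^+ 2 - 4 * n).
  by rewrite !expr2 rmorphB !rmorphM /= -a_eq -n_eq; ring.
have AB : A ^+ 2 - d * B ^+ 2 = 4 * n.
  apply: (@intr_inj rat).
  by rewrite !expr2 rmorphB !rmorphM /= -a_eq -b_eq -n_eq; ring.
have [[a' A_eq] [b' B_eq]] := even_of_norm_mod4 d_mod4 AB.
have half (q : rat) (m m' : int) :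
    2 * q = m%:~R -> m = 2 * m' -> q%:A = m'%:~R :> K.
  move=> + m_eq; rewrite m_eq intrM => /(mulfI (isT : 2 != 0 :> rat)) ->.
  by rewrite -[_%:A]/(in_alg K _) rmorph_int.
by exists a', b'; rewrite x_eq (half _ _ _ a_eq A_eq) (half _ _ _ b_eq B_eq).
Qed.

Lemma integer_field_norm (x : K) :
  ring_of_integers x -> exists n : int, field_norm x = n%:~R.
Proof.
move=> /ring_of_integersP[a [b ->]]; rewrite field_norm_int.
by exists (a ^+ 2 - d * b ^+ 2).
Qed.

(** An integer divides its norm, the cofactor being its conjugate. *)
Lemma unit_of_normP (x : K) (n : int) :
  ring_of_integers x -> field_norm x = n%:~R ->
  unit_of (@ring_of_integers K) x <-> `|n|%N = 1.
Proof.
move=> x_int x_norm; split=> [[_ [y y_int xy1]]|n1].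
  have [m y_norm] := integer_field_norm y_int.
  have nm1 : n * m = 1.
    apply: (@int_inj_ext K).
    by rewrite intrM -x_norm -y_norm -field_normM xy1 /field_norm galNorm1.
  have : (`|n|%N %| `|(n * m)%R|%N)%N by rewrite abszM dvdn_mulr.
  by rewrite nm1 dvdn1 => /eqP.
split=> //; have /ring_of_integersP[a [b x_eq]] := x_int.
have [s2 _] := K_quad.
exists (n%:~R * (a%:~R - b%:~R * s)).
  apply/ring_of_integersP; exists (n * a), (- (n * b)).
  by rewrite rmorphN !intrM /=; ring.
have n2 : n * n = 1 by lia.
rewrite mulrCA; transitivity (n%:~R * field_norm x); last first.
  by rewrite x_norm -intrM n2.
congr (_ * _).
by rewrite x_eq field_norm_int intrD intrN intrM -s2 expr2 intrM; ring.
Qed.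

Lemma irreducible_of_prime_norm (x : K) (n : int) :
  ring_of_integers x -> field_norm x = n%:~R -> prime `|n|%N ->
  irreducible_of (@ring_of_integers K) x.
Proof.
move=> x_int x_norm n_prime; split=> // [x0|x_unit|y z y_int z_int x_yz].
- have n0 : n = 0.
    by apply: (@int_inj_ext K); rewrite -x_norm x0 /field_norm galNorm0.
  by move: n_prime; rewrite n0.
- by move: n_prime; rewrite ((unit_of_normP x_int x_norm).1 x_unit).
have [k y_norm] := integer_field_norm y_int.
have [m z_norm] := integer_field_norm z_int.
have n_km : n = k * m.
  apply: (@int_inj_ext K).
  by rewrite intrM -x_norm x_yz field_normM y_norm z_norm.
have /orP[/eqP k1|/eqP m1] : (`|k|%N == 1%N) || (`|m|%N == 1%N).
  move: n_prime; rewrite n_km abszM => km_prime.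
  have /primeP[_ /(_ _ (dvdn_mulr _ (dvdnn _)))] := km_prime.
  case/orP=> [->//|]; rewrite -{1}[`|k|%N]muln1 eqn_pmul2l 1?eq_sym => [->|].
    by rewrite orbT.
  by have := prime_gt0 km_prime; rewrite muln_gt0 => /andP[].
- by left; apply/(unit_of_normP y_int y_norm).
- by right; apply/(unit_of_normP z_int z_norm).
Qed.

(** The ideal generated by 2 and [s], in coordinates.  Since [d] is even, the
    first coordinate of [s * (y s) = d y] is even, so these elements are
    stable under multiplication by [s]. *)
Lemma ideal_above_two (k : int) : d = 2 * k ->
  fractional_ideal (@ring_of_integers K)
    (fun x => exists a b : int, x = (2 * a)%:~R + b%:~R * s).
Proof.
have [s2 _] := K_quad; move=> d_eq; split.
- by exists 0, 0; rewrite mulr0 mul0r addr0.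
- move=> _ _ [a [b ->]] [a' [b' ->]]; exists (a + a'), (b + b').
  by rewrite mulrDr !intrD; ring.
- move=> _ _ /ring_of_integersP[m [n ->]] [a [b ->]].
  exists (m * a + k * n * b), (m * b + 2 * a * n).
  have -> : 2 * (m * a + k * n * b) = m * (2 * a) + d * n * b.
    by rewrite d_eq; ring.
  by rewrite !intrD !intrM -s2; ring.
- exists 2; first by exists 1, 0; rewrite mul0r addr0.
  by apply/eqP; rewrite -[2]/(2%:~R) -[0]/(0%:~R) (inj_eq (@int_inj_ext K)).
exists 1; split; first exact: ring_of_integers1.
  by apply/eqP; rewrite oner_eq0.
move=> _ [a [b ->]]; rewrite mul1r; apply/ring_of_integersP.
by exists (2 * a), b.
Qed.

(** The ideal of [ideal_above_two] has a generator [g], which is not a unit as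
    1 is not in the ideal.  Irreducibility of [x = g y] then makes [y] a unit,
    so [x] is a generator as well, and 2 is one of its multiples. *)
Lemma irreducible_even_dvd_two (k a b : int) (x : K) :
  d = 2 * k -> has_class_number (@ring_of_integers K) 1 ->
  x = (2 * a)%:~R + b%:~R * s -> irreducible_of (@ring_of_integers K) x ->
  exists2 y, ring_of_integers y & 2 = x * y.
Proof.
move=> d_eq K_class1 x_eq [_ _ _ x_irr].
have [g g0 I_g] := principal_of_class_number_one
  (ring_of_integers_fractional K) K_class1 (ideal_above_two d_eq).
have g_nonunit : ~ unit_of (@ring_of_integers K) g.
  case=> _ [y y_int gy1].
  have [e [f /esym]] := (I_g 1).2 (ex_intro2 _ _ y y_int (esym gy1)).
  rewrite -[RHS](addr0 1) -[X in _ = _ + X](mul0r s).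
  by move/(@int_coordinates_inj (2 * e) f 1 0) => []; lia.
have g_int : ring_of_integers g.
  have [e [f ->]] :=
    (I_g g).2 (ex_intro2 _ _ 1 (ring_of_integers1 K) (esym (mulr1 g))).
  by apply/ring_of_integersP; exists (2 * e), f.
have [y y_int x_gy] : exists2 y, ring_of_integers y & x = g * y.
  by apply/I_g; exists a, b.
have [//|[_ [z z_int yz1]]] := x_irr _ _ g_int y_int x_gy.
have [w w_int two_gw] : exists2 w, ring_of_integers w & 2 = g * w.
  by apply/I_g; exists 1, 0; rewrite mul0r addr0.
exists (z * w); first exact: integral_mul.
by rewrite two_gw x_gy -[LHS]mulr1 -yz1; ring.
Qed.

End QuadraticField.

(** * Irreducibility of a unit of norm -1 plus one *)

Theorem theorem1 (d : int) (d_gt1 : 1 < d) (d_sqfree : squarefreez d)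
    (d_mod4 : (d = 2 %[mod 4])%Z \/ (d = 3 %[mod 4])%Z)
    (K : splittingFieldType rat) (sqrtd : K)
    (K_quad : is_quadratic_field d sqrtd)
    (K_class1 : has_class_number (@ring_of_integers K) 1)
    (alpha u : K) (alpha_int : ring_of_integers alpha)
    (u_def : u = alpha - 1)
    (u_unit : unit_of (@ring_of_integers K) u)
    (u_norm : field_norm u = -1) :
  irreducible_of (@ring_of_integers K) alpha <->
  d = 2 /\
  u \in [:: 1 + sqrtd; 1 - sqrtd; -1 + sqrtd; -1 - sqrtd].
Proof.
have [u_int _] := u_unit.
have norm_int := field_norm_int d_gt1 d_sqfree K_quad.
have [a [b u_eq]] := (ring_of_integersP d_gt1 d_sqfree K_quad d_mod4 u).1 u_int.
have ab_norm : a ^+ 2 - d * b ^+ 2 = -1.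
  by apply: (@int_inj_ext K); rewrite -norm_int -u_eq u_norm.
have alpha_eq : alpha = (a + 1)%:~R + b%:~R * sqrtd.
  by rewrite -[alpha](subrK 1) -u_def u_eq intrD; ring.
have alpha_norm : field_norm alpha = (2 * a)%:~R.
  rewrite alpha_eq norm_int; congr (_%:~R).
  have -> : (a + 1) ^+ 2 - d * b ^+ 2 = (a ^+ 2 - d * b ^+ 2) + 2 * a + 1.
    by ring.
  by rewrite ab_norm; ring.
split=> [alpha_irr|[d2 u_mem]]; last first.
  have a1 : a = 1 \/ a = -1.
    have a_val (e f : int) : u = e%:~R + f%:~R * sqrtd -> a = e.
      by rewrite u_eq => /(int_coordinates_inj d_gt1 d_sqfree K_quad)[].
    move: u_mem; rewrite !inE.
    case/or4P=> /eqP u_s;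
      [ left; apply: (a_val 1 1) | left; apply: (a_val 1 (-1))
      | right; apply: (a_val (-1) 1) | right; apply: (a_val (-1) (-1)) ];
      by rewrite u_s ?mulrN1z ?mul1r ?mulN1r.
  apply: (irreducible_of_prime_norm d_gt1 d_sqfree K_quad d_mod4
            alpha_int alpha_norm).
  by case: a1 => ->.
have [[k d_eq] [c a_eq]] := even_odd_of_norm_minus_one d_mod4 ab_norm.
have alpha_even : alpha = (2 * (c + 1))%:~R + b%:~R * sqrtd.
  by rewrite alpha_eq a_eq; congr (_%:~R + _); ring.
have [y y_int two_alpha] := irreducible_even_dvd_two d_gt1 d_sqfree K_quad
  d_mod4 d_eq K_class1 alpha_even alpha_irr.
have [m y_norm] := integer_field_norm d_gt1 d_sqfree K_quad d_mod4 y_int.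
have am2 : 2 = a * m.
  suff : 2 * 2 = 2 * (a * m) :> int by move/(mulfI (isT : 2 != 0 :> int)).
  apply: (@int_inj_ext K).
  rewrite mulrA (intrM _ (2 * a) m) -alpha_norm -y_norm -field_normM -two_alpha.
  have -> : 2 = 2%:~R + 0%:~R * sqrtd :> K by rewrite mul0r addr0.
  by rewrite norm_int mulr0 subr0.
have a1 : a = 1 \/ a = -1.
  have : (`|a| %| 2)%N by apply/dvdnP; exists `|m|%N; lia.
  by rewrite dvdn_divisors // !inE => /orP[] /eqP; lia.
have db2 : d * b ^+ 2 = 2 by case: a1 ab_norm => ->; lia.
have b1 : b = 1 \/ b = -1 by nia.
have d2 : d = 2 by case: b1 db2 => ->; lia.
split=> //; rewrite u_eq !inE; apply/or4P.
by case: a1 b1 => -> [] ->;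
  [constructor 1 | constructor 2 | constructor 3 | constructor 4];
  rewrite ?mulN1r ?mul1r.
Qed.
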